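(* Let $n,d\ge1$, let $X_1,\dots,X_n\in\mathbb{R}^d$ and let $\Sigma_1,\dots,\Sigma_n$ be $d\times d$ symmetric positive-definite matrices. Define the ridgeline manifold $$\mathcal{M}:=\{x^*(\alpha):\alpha\in\Delta_{n-1}\},\qquad x^*(\alpha):=\Big(\sum_{i=1}^n\alpha_i\Sigma_i^{-1}\Big)^{-1}\sum_{i=1}^n\alpha_i\Sigma_i^{-1}X_i .$$ Then $\mathcal{M}$ is a compact subset of $\mathbb{R}^d$, and the support of every maximizer $\widehat G_n$ of $\ell_n(G)=\frac1n\sum_{i=1}^n\log f_{G,\Sigma_i}(X_i)$ over $G\in\mathcal{P}(\mathbb{R}^d)$ is contained in $\mathcal{M}$. Moreover, for any $\alpha\in\Delta_{n-1}$ there is an $\alpha'\in\Delta_{n-1}$ with at most $d+1$ nonzero entries such that $x^*(\alpha)=x^*(\alpha')$.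
   Context: $\Delta_{n-1}=\{\alpha\in\mathbb{R}^n:\alpha_i\ge0,\ \sum_i\alpha_i=1\}$. $\mathcal{P}(\mathbb{R}^d)$ is the set of all Borel probability measures on $\mathbb{R}^d$. For a symmetric positive-definite matrix $\Sigma$, $\varphi_\Sigma(x)=\det(2\pi\Sigma)^{-1/2}\exp(-\frac12x^{\mathsf T}\Sigma^{-1}x)$ and $f_{G,\Sigma}(x):=\int\varphi_\Sigma(x-\theta)\,dG(\theta)$. *)

(* Defs.v *)
From HB Require Import structures.
From mathcomp Require Import all_boot all_order all_algebra.
From mathcomp Require Import all_classical all_reals all_analysis.

Set Implicit Arguments.
Unset Strict Implicit.
Unset Printing Implicit Defensive.

Import Order.TTheory GRing.Theory Num.Theory numFieldNormedType.Exports.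

Local Open Scope classical_set_scope.
Local Open Scope ring_scope.

(* 'cV[R]_d with the sigma-algebra generated by its open sets. *)
Definition borel_cV (R : realType) (d : nat) :=
  g_sigma_algebraType [set U : set 'cV[R]_d | open U].

Definition posdefmx (R : realType) (d : nat) (S : 'M[R]_d) : Prop :=
  S^T = S /\ forall v : 'cV[R]_d, v != 0 -> 0 < (v^T *m S *m v) 0 0.

(* n is the number of coordinates, not the dimension of the simplex. *)
Definition simplex (R : realType) (n : nat) : set 'cV[R]_n :=
  [set a | (forall i, 0 <= a i 0) /\ \sum_i a i 0 = 1].
Arguments simplex : clear implicits.

Definition gauss_density (R : realType) (d : nat) (S : 'M[R]_d)
    (x : 'cV[R]_d) : R :=
  (\det ((2 * pi) *: S)) `^ (- 2^-1) *
  expR (- 2^-1 * (x^T *m invmx S *m x) 0 0).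

(* For S positive definite the integrand is bounded, continuous and positive,
   so the integral is a positive real: neither [fine] inside Rintegral nor [ln]
   in log_likelihood ever meets a junk value. *)
Definition gauss_mixture (R : realType) (d : nat)
    (G : probability (borel_cV R d) R) (S : 'M[R]_d) (x : 'cV[R]_d) : R :=
  \int[G]_theta gauss_density S (x - theta).

Definition log_likelihood (R : realType) (n d : nat)
    (X : 'I_n -> 'cV[R]_d) (S : 'I_n -> 'M[R]_d)
    (G : probability (borel_cV R d) R) : R :=
  n%:R^-1 * \sum_i ln (gauss_mixture G (S i) (X i)).

Definition is_maximizer (R : realType) (T : Type) (l : T -> R) (t : T) : Prop :=
  forall t', l t' <= l t.

Definition msupport (R : realType) (d : nat)
    (G : probability (borel_cV R d) R) : set 'cV[R]_d :=
  [set x | forall U : set 'cV[R]_d, open U -> U x -> (0 < G U)%E].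

Definition ridgeline (R : realType) (n d : nat)
    (X : 'I_n -> 'cV[R]_d) (S : 'I_n -> 'M[R]_d) (a : 'cV[R]_n) : 'cV[R]_d :=
  invmx (\sum_i a i 0 *: invmx (S i)) *m \sum_i a i 0 *: (invmx (S i) *m X i).

Definition ridgeline_manifold (R : realType) (n d : nat)
    (X : 'I_n -> 'cV[R]_d) (S : 'I_n -> 'M[R]_d) : set 'cV[R]_d :=
  ridgeline X S @` simplex R n.

(* Main.v *)
(* The first-order condition for [x = ridgeline X Sigma a] is that the convex
   combination with weights [a] of the vectors [invmx (Sigma i) *m (x - X i)]
   vanishes, so Caratheodory's theorem applied to these vectors gives the
   sparse weights. If [x] is off the manifold, Gordan's theorem gives a
   translation that strictly decreases all the Mahalanobis distances to the
   [X i] at [x], hence on a neighbourhood [U] of [x]. If [x] were in the support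
   of [G], then translating the mass of [G] lying in [U] would strictly increase
   every mixture density, and [G] would not be a maximizer. *)
Require Import Defs.
From HB Require Import structures.
From mathcomp Require Import all_boot all_order all_algebra.
From mathcomp Require Import all_classical all_reals all_analysis.
From mathcomp Require Import measurable_realfun ring lra.

Set Implicit Arguments.
Unset Strict Implicit.
Unset Printing Implicit Defensive.

Import numFieldNormedType.Exports.
Import Order.TTheory GRing.Theory Num.Theory.
Local Open Scope classical_set_scope.
Local Open Scope ring_scope.

(** * Sparse convex weights *)

(** Induction on the size of the support of [a]. When it exceeds [d.+1], the vectors [u i] extended
    by a coordinate 1 are linearly dependent over the support, and [a] can be moved along the
    dependency, without changing its total or its combination, until a weight vanishes. *)
Lemma caratheodory (R : realType) (n d : nat) (u : 'I_n -> 'cV[R]_d)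
    (a : 'cV[R]_n) :
  simplex R n a ->
  exists a' : 'cV[R]_n,
    [/\ simplex R n a', (#|[pred i | a' i 0%R != 0%R]| <= d.+1)%N
      & \sum_i a' i 0 *: u i = \sum_i a i 0 *: u i].
Proof.
have [m] := ubnP #|[pred i | a i 0%R != 0%R]|.
elim: m => // m IHm in a * => /ltnSE le_am [a_ge0 a_sum].
have [small|big] := leqP #|[pred i | a i 0%R != 0%R]| d.+1; first by exists a.
pose A : pred 'I_n := [pred i | a i 0 != 0].
pose M : 'M[R]_(#|A|, d + 1) :=
  \matrix_k row_mx (u (enum_val k))^T (const_mx 1).
have /rowV0Pn[v /sub_kermxP vM v_neq0] : kermx M != 0.
  rewrite kermx_eq0 /row_free neq_ltn; apply/orP; left.
  by rewrite (leq_ltn_trans (rank_leq_col M)) ?addn1.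
have [k0 vk0] : exists k, v 0 k != 0.
  by apply/rV0Pn.
pose Ak0 := enum_valP k0.
(* [b] is an affine dependency of the [u i] supported on the support of [a]. *)
pose b i := if i \in A then v 0 (enum_rank_in Ak0 i) else 0.
have b_val k : b (enum_val k) = v 0 k.
  by rewrite /b enum_valP enum_valK_in.
have b_sum (V : lmodType R) (F : 'I_n -> V) :
    \sum_i b i *: F i = \sum_k v 0 k *: F (enum_val k).
  transitivity (\sum_(i in A) b i *: F i).
    rewrite [RHS]big_mkcond; apply: eq_bigr => i _.
    by rewrite /b; case: ifP => // _; rewrite scale0r.
  by rewrite big_enum_val; apply: eq_bigr => k _; rewrite b_val.
have bu0 : \sum_i b i *: u i = 0.
  rewrite b_sum; apply/colP => j; rewrite mxE summxE.
  have /rowP/(_ (lshift 1 j)) := vM; rewrite !mxE; apply: etrans.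
  by apply: eq_bigr => k _; rewrite [M _ _]mxE row_mxEl !mxE.
have b1_0 : \sum_i b i = 0.
  have /rowP/(_ (rshift d 0)) := vM; rewrite !mxE; apply: etrans.
  (* Scalars are viewed as vectors of [R^o], so that [b_sum] applies to them. *)
  transitivity (\sum_i b i *: (1 : R^o)).
    by apply: eq_bigr => i _; rewrite /GRing.scale /= mulr1.
  rewrite b_sum; apply: eq_bigr => k _.
  by rewrite [M _ _]mxE row_mxEr mxE.
(* The entries of [b] sum to zero and are not all zero, so one is positive. *)
have [i1 bi1_gt0] : exists i, 0 < b i.
  apply/existsP/contraT; rewrite negb_exists => /forallP b_le0.
  have /eqP := b1_0; rewrite -oppr_eq0 -sumrN psumr_eq0; last first.
    by move=> i _; rewrite oppr_ge0 leNgt.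
  move=> /allP/(_ (enum_val k0)); rewrite mem_index_enum oppr_eq0 b_val.
  by rewrite (negbTE vk0) => /(_ isT).
pose P := [pred i | 0 < b i].
have Pi1 : P i1 by [].
have [i0 bi0_gt0 i0_min] :=
  @Order.TotalTheory.arg_minP _ R _ i1 P (fun i => a i 0 / b i) Pi1.
(* The largest step along [-b] that keeps every weight nonnegative; it brings the weight at [i0] to
   zero. *)
pose t := a i0 0 / b i0.
have t_ge0 : 0 <= t by rewrite divr_ge0 ?a_ge0 // ltW.
pose a' : 'cV[R]_n := \col_i (a i 0 - t * b i).
have a'_simplex : simplex R n a'.
  split=> [i|]; last first.
    under eq_bigr do rewrite mxE.
    by rewrite sumrB -mulr_sumr b1_0 mulr0 subr0.
  rewrite mxE subr_ge0; have [bi_le0|bi_gt0] := leP (b i) 0.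
    by rewrite (le_trans _ (a_ge0 i)) // mulr_ge0_le0.
  by rewrite -ler_pdivlMr // i0_min.
have supp_a' : (#|[pred i | a' i 0%R != 0%R]| < m)%N.
  apply: leq_trans le_am; apply: proper_card; apply/properP; split.
    apply/fintype.subsetP => i; rewrite !inE mxE; apply: contraNneq => ai0.
    by rewrite /b inE ai0 eqxx /= mulr0 subrr.
  exists i0; last by rewrite inE mxE divfK ?subrr ?eqxx // gt_eqF.
  rewrite inE; apply: contraTneq bi0_gt0 => ai0.
  by rewrite /= /b inE ai0 eqxx ltxx.
have [a'' [a''_simplex a''_card a''_sum]] := IHm _ supp_a' a'_simplex.
exists a''; split => //; rewrite a''_sum.
under eq_bigr do rewrite mxE scalerBl -scalerA.
by rewrite sumrB -scaler_sumr bu0 scaler0 subr0.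
Qed.

(** * Continuity of matrix expressions *)

(** A neighbourhood of a matrix contains a product of neighbourhoods of its entries, and a finite
    intersection of such conditions stays in the filter. *)
Lemma continuous_mx (T U : topologicalType) (m n : nat) (f : T -> 'M[U]_(m, n))
    (x : T) :
  (forall i j, {for x, continuous (fun t => f t i j)}) -> {for x, continuous f}.
Proof.
move=> f_cont A [P fxP PA]; rewrite /= nbhs_filterE /=.
apply: (@filterS _ _ _ [set t | forall i j, P i j (f t i j)]).
  by move=> t Pt; apply: PA => i j; exact: Pt.
apply: filter_forall => i; apply: filter_forall => j.
exact: f_cont (fxP i j).
Qed.

Lemma continuous_sum_at (R : realType) (T : topologicalType) (I : Type)
    (r : seq I) (P : pred I) (f : I -> T -> R) (x : T) :
  (forall i, {for x, continuous (f i)}) ->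
  {for x, continuous (fun t => \sum_(i <- r | P i) f i t)}.
Proof.
by move=> f_cont; apply: cvg_big => [|i _]; [exact: add_continuous|exact: f_cont].
Qed.

Lemma continuous_prod_at (R : realType) (T : topologicalType) (I : Type)
    (r : seq I) (P : pred I) (f : I -> T -> R) (x : T) :
  (forall i, {for x, continuous (f i)}) ->
  {for x, continuous (fun t => \prod_(i <- r | P i) f i t)}.
Proof.
by move=> f_cont; apply: cvg_big => [|i _]; [exact: mul_continuous|exact: f_cont].
Qed.

Lemma continuous_det (R : realType) (T : topologicalType) (n : nat)
    (f : T -> 'M[R]_n) (x : T) :
  (forall i j, {for x, continuous (fun t => f t i j)}) ->
  {for x, continuous (fun t => \det (f t))}.
Proof.
move=> f_cont; apply: continuous_sum_at => s.
apply: continuousM; first exact: cst_continuous.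
by apply: continuous_prod_at => i; exact: f_cont.
Qed.

Lemma continuous_quad_form (R : realType) (d : nat) (W : 'M[R]_d)
    (T : topologicalType) (f : T -> 'cV[R]_d) (x : T) :
  {for x, continuous f} ->
  {for x, continuous (fun t => ((f t)^T *m W *m f t) 0 0)}.
Proof.
move=> f_cont.
have f_coord i : {for x, continuous (fun t => f t i 0)}.
  apply: (@continuous_comp _ _ _ f (fun M : 'cV[R]_d => M i 0)) => //.
  exact: coord_continuous.
rewrite (_ : (fun t => _) =
    (fun t => \sum_j (\sum_i f t i 0 * W i j) * f t j 0)); last first.
  apply/funext => t; rewrite mxE; apply: eq_bigr => j _; rewrite mxE.
  by congr (_ * _); apply: eq_bigr => i _; rewrite mxE.
apply: continuous_sum_at => j; apply: continuousM; last exact: f_coord.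
apply: continuous_sum_at => i; apply: continuousM; first exact: f_coord.
exact: cst_continuous.
Qed.

(** * Compactness of the simplex and separation of a convex hull from the origin *)

(** The simplex is closed in the unit cube. The cube is compact as a product of segments, stated for
    row vectors and carried over by transposition. *)
Lemma simplex_compact (R : realType) (n : nat) : compact (simplex R n).
Proof.
pose B := [set v : 'rV[R]_n | forall i, `[0, 1]%classic (v ord0 i)].
have B_compact : compact ((trmx : 'rV[R]_n -> 'cV[R]_n) @` B).
  apply: continuous_compact.
    apply: continuous_subspaceT => v; apply: continuous_mx => i j.
    rewrite (_ : (fun t : 'rV[R]_n => t^T i j) = fun t => t j i).
      exact: coord_continuous.
    by apply/funext => t; rewrite mxE.
  by apply: (@rV_compact R n (fun=> `[0, 1]%classic)) => i; exact: segment_compact.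
apply: subclosed_compact B_compact _.
  have -> : simplex R n =
      \bigcap_i [set a : 'cV[R]_n | 0 <= a i 0] `&`
      [set a : 'cV[R]_n | \sum_i a i 0 = 1].
    by apply/seteqP; split=> a [a_ge0 a_sum]; split=> // i; [move=> _|]; exact: a_ge0.
  apply: closedI.
    apply: closed_bigI => i _.
    apply: (@closed_comp _ _ (fun a : 'cV[R]_n => a i 0) [set x | 0 <= x]).
      by move=> x _; exact: coord_continuous.
    exact: closed_ge.
  apply: (@closed_comp _ _ (fun a : 'cV[R]_n => \sum_i a i 0) [set x | x = 1]).
    by move=> x _; apply: continuous_sum_at => i; exact: coord_continuous.
  exact: closed_eq.
move=> a [a_ge0 a_sum]; exists a^T; last by rewrite trmxK.
move=> i; rewrite /= mxE in_itv /= a_ge0 -a_sum (bigD1 i) //= lerDl.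
by apply: sumr_ge0.
Qed.

(* The witness is the point of least Euclidean norm in the convex hull. *)
Lemma gordan (R : realType) (n d : nat) (u : 'I_n -> 'cV[R]_d) :
  (0 < n)%N -> (forall a, simplex R n a -> \sum_i a i 0 *: u i <> 0) ->
  exists v : 'cV[R]_d, exists2 c : R, 0 < c & forall i, c <= (v^T *m u i) 0 0.
Proof.
move=> n_gt0 hull_n0.
pose comb (a : 'cV[R]_n) := \sum_i a i 0 *: u i.
pose sqn (p : 'cV[R]_d) := (p^T *m p) 0 0.
have comb_cont : continuous comb.
  move=> a; apply: continuous_mx => j k.
  rewrite (_ : (fun t => comb t j k) = (fun t : 'cV[R]_n => \sum_i t i 0 * u i j k)); last first.
    by apply/funext => t; rewrite summxE; apply: eq_bigr => i _; rewrite mxE.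
  apply: continuous_sum_at => i; apply: continuousM; last exact: cst_continuous.
  exact: coord_continuous.
have delta_simplex i : simplex R n (delta_mx i 0).
  split=> [j|]; first by rewrite mxE; case: (_ && _).
  rewrite (bigD1 i) //= big1 ?addr0 => [|j /negbTE ji]; rewrite mxE ?eqxx //.
  by rewrite ji.
have [a] : exists2 a, a \in simplex R n &
    forall b, b \in simplex R n -> sqn (comb a) <= sqn (comb b).
  apply: compact_EVT_min.
  - by exists (delta_mx (Ordinal n_gt0) 0).
  - exact: simplex_compact.
  - apply: (@continuous_subspaceT _ _ _ (sqn \o comb)) => a.
    rewrite (_ : sqn \o comb = (fun t => ((comb t)^T *m 1%:M *m comb t) 0 0)).
      by apply: continuous_quad_form; exact: comb_cont.
    by apply/funext => t; rewrite mulmx1.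
rewrite inE => -[a_ge0 a_sum] a_min.
pose p := comb a.
have sqnE (q : 'cV[R]_d) : sqn q = \sum_i q i 0 ^+ 2.
  by rewrite /sqn mxE; apply: eq_bigr => i _; rewrite mxE.
have sqn_gt0 : 0 < sqn p.
  rewrite lt_def sqnE sumr_ge0 => [|i _]; last exact: sqr_ge0.
  rewrite andbT psumr_eq0 => [|i _]; last exact: sqr_ge0.
  apply/negP => /allP p0; apply: (hull_n0 a) => //.
  apply/colP => i; rewrite [RHS]mxE; apply/eqP; rewrite -sqrf_eq0.
  by apply: p0; rewrite mem_index_enum.
exists p, (sqn p) => // i.
pose w := u i - p.
pose D := (p^T *m w) 0 0.
(* The point [p + t *: w] lies on the segment from [p] to [u i], hence in the hull; expanding its
   squared norm against the minimum gives the inequality. *)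
have main t : 0 <= t <= 1 -> 0 <= t * (2 * D + t * sqn w).
  move=> /andP[t_ge0 t_le1].
  pose b := (1 - t) *: a + t *: delta_mx i 0.
  have b_simplex : simplex R n b.
    have [i_ge0 i_sum] := delta_simplex i; split=> [j|].
      by rewrite !mxE addr_ge0 // mulr_ge0 ?subr_ge0 ?a_ge0 //; case: (_ && _).
    transitivity (\sum_j ((1 - t) * a j 0 + t * (delta_mx i 0 : 'cV[R]_n) j 0)).
      by apply: eq_bigr => j _; rewrite !mxE.
    by rewrite big_split -!mulr_sumr /= a_sum i_sum !mulr1 subrK.
  have combE : comb b = p + t *: w.
    rewrite /comb /b.
    transitivity (\sum_j ((1 - t) *: (a j 0 *: u j)
        + t *: ((delta_mx i 0 : 'cV[R]_n) j 0 *: u j))).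
      by apply: eq_bigr => j _; rewrite !mxE !scalerA scalerDl.
    rewrite big_split -!scaler_sumr /= -/(comb a) -/p.
    have -> : \sum_j (delta_mx i 0 : 'cV[R]_n) j 0 *: u j = u i.
      rewrite (bigD1 i) //= big1 ?addr0 => [|j /negbTE ji]; rewrite mxE.
        by rewrite !eqxx scale1r.
      by rewrite ji scale0r.
    by apply/colP => k; rewrite !mxE; ring.
  have := a_min b; rewrite inE => /(_ b_simplex); rewrite combE -subr_ge0 -/p.
  rewrite !sqnE; congr (0 <= _).
  rewrite -sumrB /D mxE !mulr_sumr -big_split mulr_sumr /=.
  by apply: eq_bigr => j _; rewrite !mxE; ring.
have D_ge0 : 0 <= D.
  rewrite leNgt; apply/negP => D_lt0.
  have sqnw_ge0 : 0 <= sqn w by rewrite sqnE sumr_ge0 // => j _; exact: sqr_ge0.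
  have den_gt0 : 0 < sqn w - D by rewrite subr_gt0 (lt_le_trans D_lt0).
  (* This [t] lies in (0, 1] and turns [2 * D + t * sqn w] into [D + D * t], which is negative,
     against [main]. *)
  pose t := - D / (sqn w - D).
  have t_gt0 : 0 < t by rewrite divr_gt0 ?oppr_gt0.
  have t_le1 : t <= 1 by rewrite ler_pdivrMr // mul1r lerDr.
  have := main t; rewrite (ltW t_gt0) t_le1 => /(_ isT).
  rewrite pmulr_rge0 // leNgt; apply/negP/negPn.
  have -> : 2 * D + t * sqn w = D + D * t.
    by rewrite /t; field; rewrite gt_eqF.
  by rewrite ltr_wnDr // nmulr_rle0 // ltW.
move: D_ge0; rewrite /D /w mulmxBr mxE [X in _ + X]mxE subr_ge0.
by [].
Qed.

(** * Positive-definite matrices and the ridgeline *)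

Lemma posdefmx_unit (R : realType) (d : nat) (S : 'M[R]_d) :
  posdefmx S -> S \in unitmx.
Proof.
case=> _ S_pos; rewrite -row_free_unit -kermx_eq0; apply/negP => /negP.
move=> /rowV0Pn[v /sub_kermxP vS v_neq0].
have vT_neq0 : v^T != 0 by rewrite trmx_eq0.
by have := S_pos _ vT_neq0; rewrite trmxK vS mul0mx mxE ltxx.
Qed.

(** The form of [invmx S] at [v] is the form of [S] at [invmx S *m v]. *)
Lemma posdefmx_inv (R : realType) (d : nat) (S : 'M[R]_d) :
  posdefmx S -> posdefmx (invmx S).
Proof.
move=> S_pd; have S_unit := posdefmx_unit S_pd; case: S_pd => S_sym S_pos.
have inv_sym : (invmx S)^T = invmx S by rewrite trmx_inv S_sym.
split=> // v v_neq0; have := S_pos (invmx S *m v).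
rewrite trmx_mul inv_sym -!mulmxA (mulmxA S) mulmxV // mul1mx; apply.
by apply: contra v_neq0 => /eqP Sv0; rewrite -(mulKVmx S_unit v) Sv0 mulmx0.
Qed.

Lemma posdefmx_comb (R : realType) (n d : nat) (W : 'I_n -> 'M[R]_d)
    (a : 'cV[R]_n) :
  simplex R n a -> (forall i, posdefmx (W i)) ->
  posdefmx (\sum_i a i 0 *: W i).
Proof.
move=> [a_ge0 a_sum] W_pd; split=> [|v v_neq0].
  rewrite raddf_sum; apply: eq_bigr => i _ /=.
  by rewrite linearZ /=; have [-> _] := W_pd i.
have qE : (v^T *m (\sum_i a i 0 *: W i) *m v) 0 0
    = \sum_i a i 0 * (v^T *m W i *m v) 0 0.
  rewrite mulmx_sumr mulmx_suml summxE; apply: eq_bigr => i _.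
  by rewrite -scalemxAr -scalemxAl mxE.
have q_gt0 i : 0 < (v^T *m W i *m v) 0 0 by have [_] := W_pd i; exact.
have term_ge0 i : 0 <= a i 0 * (v^T *m W i *m v) 0 0.
  by rewrite mulr_ge0 ?a_ge0 // ltW.
rewrite qE lt_def sumr_ge0 // andbT psumr_eq0 //.
apply/negP => /allP all0; have /eqP := a_sum; rewrite big1 => [|i _].
  by rewrite eq_sym oner_eq0.
have := all0 i; rewrite mem_index_enum mulf_eq0 (gt_eqF (q_gt0 i)) orbF.
by move=> /(_ isT)/eqP.
Qed.

(** For a fixed [x] this replaces a rational dependence on [a] by a linear condition, the form in
    which [caratheodory] and [gordan] apply. The sum is [A *m x - b] with [A] invertible, where the
    ridgeline point is [invmx A *m b]. *)
Lemma ridgelineP (R : realType) (n d : nat) (X : 'I_n -> 'cV[R]_d)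
    (S : 'I_n -> 'M[R]_d) (a : 'cV[R]_n) (x : 'cV[R]_d) :
  (forall i, posdefmx (S i)) -> simplex R n a ->
  ridgeline X S a = x <-> \sum_i a i 0 *: (invmx (S i) *m (x - X i)) = 0.
Proof.
move=> S_pd a_simplex.
have A_unit := posdefmx_unit
  (posdefmx_comb a_simplex (fun i => posdefmx_inv (S_pd i))).
have -> : \sum_i a i 0 *: (invmx (S i) *m (x - X i)) =
    (\sum_i a i 0 *: invmx (S i)) *m x - \sum_i a i 0 *: (invmx (S i) *m X i).
  rewrite mulmx_suml -sumrB; apply: eq_bigr => i _.
  by rewrite mulmxBr scalerBr scalemxAl.
rewrite /ridgeline; split=> [<-|/subr0_eq <-]; last by rewrite mulKmx.
by rewrite mulKVmx // subrr.
Qed.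

(* By Cramer's rule, the ridgeline is a rational function of [a]. *)
Lemma ridgeline_manifold_compact (R : realType) (n d : nat)
    (X : 'I_n -> 'cV[R]_d) (S : 'I_n -> 'M[R]_d) :
  (forall i, posdefmx (S i)) -> compact (ridgeline_manifold X S).
Proof.
move=> S_pd; apply: continuous_compact; last exact: simplex_compact.
pose A (a : 'cV[R]_n) := \sum_i a i 0 *: invmx (S i).
pose b (a : 'cV[R]_n) := \sum_i a i 0 *: (invmx (S i) *m X i).
have comb_cont m p (F : 'I_n -> 'M[R]_(m, p)) j k :
    continuous (fun a : 'cV[R]_n => (\sum_i a i 0 *: F i) j k).
  move=> a; rewrite (_ : (fun t => _) =
      (fun t : 'cV[R]_n => \sum_i t i 0 * F i j k)); last first.
    by apply/funext => t; rewrite summxE; apply: eq_bigr => i _; rewrite mxE.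
  apply: continuous_sum_at => i; apply: continuousM; last exact: cst_continuous.
  exact: coord_continuous.
pose r a := (\det (A a))^-1 *: (\adj (A a) *m b a).
have r_cont : {in simplex R n, continuous r}.
  move=> a; rewrite inE => a_simplex; apply: continuous_mx => i j.
  rewrite (_ : (fun t => r t i j) = fun t : 'cV[R]_n =>
    (\det (A t))^-1 * \sum_k cofactor (A t) k i * b t k j); last first.
    apply/funext => t; rewrite !mxE; congr (_ * _).
    by apply: eq_bigr => k _; rewrite mxE.
  apply: continuousM.
    apply: continuousV.
      rewrite -unitfE; apply: posdefmx_unit.
      exact: posdefmx_comb a_simplex (fun i => posdefmx_inv (S_pd i)).
    by apply: continuous_det => k l; exact: comb_cont.
  apply: continuous_sum_at => k; apply: continuousM; last exact: comb_cont.
  apply: continuousM; first exact: cst_continuous.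
  apply: continuous_det => l m.
  rewrite (_ : (fun t => _) = fun t => A t (lift k l) (lift i m)); last first.
    by apply/funext => t; rewrite !mxE.
  exact: comb_cont.
(* [invmx] leaves a singular matrix unchanged, so [r] is identified with the ridgeline only on the
   simplex, where [A a] is invertible. *)
move: (continuous_in_subspaceT r_cont).
apply: subspace_eq_continuous => a; rewrite inE => a_simplex.
rewrite /ridgeline /from_subspace /r /invmx ifT ?scalemxAl //.
apply: posdefmx_unit.
exact: posdefmx_comb a_simplex (fun i => posdefmx_inv (S_pd i)).
Qed.

(** * Gaussian densities *)

(** [powR] is an exponential as soon as its base is nonzero, so it is enough that the determinant
    does not vanish. *)
Lemma gauss_const_gt0 (R : realType) (d : nat) (S : 'M[R]_d) :
  posdefmx S -> 0 < (\det ((2 * pi) *: S)) `^ (- 2^-1).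
Proof.
move=> /posdefmx_unit; rewrite unitmxE unitfE => detS.
rewrite /powR ifF ?expR_gt0 // detZ; apply/negbTE.
by rewrite mulf_neq0 // expf_neq0 // mulf_neq0 ?pnatr_eq0 // gt_eqF // pi_gt0.
Qed.

Lemma gauss_density_gt0 (R : realType) (d : nat) (S : 'M[R]_d) x :
  posdefmx S -> 0 < gauss_density S x.
Proof. by move=> S_pd; rewrite mulr_gt0 ?gauss_const_gt0 ?expR_gt0. Qed.

Lemma gauss_density_lt (R : realType) (d : nat) (S : 'M[R]_d) x y :
  posdefmx S ->
  (x^T *m invmx S *m x) 0 0 < (y^T *m invmx S *m y) 0 0 ->
  gauss_density S y < gauss_density S x.
Proof.
move=> S_pd xy; rewrite /gauss_density ltr_pM2l ?gauss_const_gt0 // ltr_expR.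
by rewrite ltr_nM2l // oppr_lt0 invr_gt0.
Qed.

Lemma gauss_density_le0 (R : realType) (d : nat) (S : 'M[R]_d) x :
  posdefmx S -> gauss_density S x <= gauss_density S 0.
Proof.
move=> S_pd; have [->//|x_neq0] := eqVneq x 0.
apply/ltW/gauss_density_lt => //; rewrite mulmx0 mxE.
by have [_] := posdefmx_inv S_pd; exact.
Qed.

Lemma gauss_density_continuous (R : realType) (d : nat) (S : 'M[R]_d)
    (y : 'cV[R]_d) :
  continuous (fun x : 'cV[R]_d => gauss_density S (y - x)).
Proof.
move=> x; pose q (t : 'cV[R]_d) := ((y - t)^T *m invmx S *m (y - t)) 0 0.
have q_cont : {for x, continuous q}.
  apply: continuous_quad_form.
  by apply: continuousB; [exact: cst_continuous|exact: (fun _ => cvg_id)].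
have e_cont : {for x, continuous (fun t => expR (- 2^-1 * q t))}.
  apply: (@continuous_comp _ _ _ (fun t => - 2^-1 * q t) (@expR R)).
    by apply: continuousM => //; exact: cst_continuous.
  exact: continuous_expR.
by rewrite /gauss_density; apply: continuousM e_cont; exact: cst_continuous.
Qed.

(** * Integration against Borel probability measures *)

Lemma bounded_integrable (R : realType) (disp : measure_display)
    (T : measurableType disp) (P : probability T R) (f : T -> R) (c : R) :
  measurable_fun setT f -> (forall x, 0 <= f x <= c) ->
  P.-integrable setT (EFin \o f).
Proof.
move=> f_meas f_bnd; apply: measurable_bounded_integrable => //.
  exact: le_lt_trans (probability_le1 P measurableT) (ltry _).
exists c; split; first exact: num_real.
move=> x cx y _ /=; have /andP[f_ge0 f_le] := f_bnd y.
by rewrite ger0_norm // (le_trans f_le) // ltW.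
Qed.

(** If the integral were zero, [f] would vanish outside a null set; as [f] never vanishes, that null
    set would be the whole space, of measure one. *)
Lemma Rintegral_gt0 (R : realType) (disp : measure_display)
    (T : measurableType disp) (P : probability T R) (f : T -> R) :
  P.-integrable setT (EFin \o f) -> (forall x, 0 < f x) ->
  0 < \int[P]_x f x.
Proof.
move=> f_int f_gt0.
have f_meas : measurable_fun setT (EFin \o f) by case/integrableP: f_int.
rewrite lt_def Rintegral_ge0 => [|x _]; last exact: ltW.
rewrite andbT; apply/eqP => int0.
have : (\int[P]_x `|(f x)%:E| = 0)%E.
  rewrite (eq_integral (EFin \o f)); last first.
    by move=> x _; rewrite /= gtr0_norm.
  (* Integrability makes the integral finite, so a zero of [fine] is a true zero and not its default
     value at infinity. *)
  have /fineK <- := integrable_fin_num measurableT f_int.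
  by move: int0; rewrite /Rintegral => ->.
move=> /(ae_eq_integral_abs _ measurableT f_meas)[N [N_meas N0 subN]].
have : (P setT <= P N)%E.
  apply: le_measure; rewrite ?inE // => x _; apply: subN => /= /(_ I) [fx0].
  by have := f_gt0 x; rewrite fx0 ltxx.
by rewrite N0 probability_setT lee_fin ler10.
Qed.

Lemma borel_open (R : realType) (d : nat) (U : set 'cV[R]_d) :
  open U -> measurable (U : set (borel_cV R d)).
Proof. by move=> U_open; exact: sub_sigma_algebra. Qed.

Lemma continuous_borel (R : realType) (d : nat) (f : 'cV[R]_d -> R) :
  continuous f -> measurable_fun setT (f : borel_cV R d -> R).
Proof.
move=> f_cont; apply: (measurability _ (RGenOpens.measurableE R)).
move=> _ [_ [x [y ->]] <-]; rewrite setTI; apply: borel_open.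
by apply: open_comp => [z _|]; [exact: f_cont|exact: interval_open].
Qed.

(** * Translating the mass that lies in an open set *)

Section transport.
Context (R : realType) (d : nat) (G : probability (borel_cV R d) R).
Context (U : set 'cV[R]_d) (U_open : open U) (v : 'cV[R]_d).

Definition shift_on (x : borel_cV R d) : borel_cV R d :=
  if x \in U then (x : 'cV[R]_d) - v else x.

Lemma measurable_shift_on : measurable_fun setT shift_on.
Proof.
apply: (@measurability _ _ _ (borel_cV R d) _ _ [set V : set 'cV[R]_d | open V])
  => [//|_ [V V_open <-]]; rewrite setTI.
have -> : shift_on @^-1` V =
    (U `&` (fun x : 'cV[R]_d => x - v) @^-1` V) `|` (~` U `&` V).
  apply/seteqP; split=> x /=; rewrite /shift_on.
    by case: ifPn => [/set_mem|/negP/[!inE]] Ux Vx; [left|right].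
  by case=> -[Ux Vx]; [rewrite mem_set|rewrite memNset].
apply: measurableU; apply: measurableI.
- exact: borel_open.
- apply: borel_open; apply: open_comp => // x _.
  by apply: continuousB; [exact: (fun _ => cvg_id)|exact: cst_continuous].
- by apply: measurableC; exact: borel_open.
- exact: borel_open.
Qed.

HB.instance Definition _ :=
  isMeasurableFun.Build _ _ _ _ shift_on measurable_shift_on.

Definition shifted_measure : probability (borel_cV R d) R :=
  distribution G shift_on.

(** By change of variables the right-hand side integrates [f \o shift_on] against [G]. This function
    dominates [f] plus [e] times the indicator of [U], whose integral exceeds that of [f] by [e]
    times the mass of [U]. *)
Lemma Rintegral_shifted_gt (f : 'cV[R]_d -> R) (c e : R) :
  continuous f -> (forall x, 0 <= f x <= c) -> 0 < e ->
  (forall x, U x -> f x + e <= f (x - v)) -> (0 < G U)%E ->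
  \int[G]_x f x < \int[shifted_measure]_x f x.
Proof.
move=> f_cont f_bnd e_gt0 f_incr U_gt0.
have f_meas := continuous_borel f_cont.
have U_meas := borel_open U_open.
have fT_int : G.-integrable setT (EFin \o (f \o shift_on)).
  apply: bounded_integrable => [|x]; last exact: f_bnd.
  exact: measurableT_comp f_meas measurable_shift_on.
have f_int : G.-integrable setT (EFin \o f).
  exact: (@bounded_integrable _ _ (borel_cV R d) G f c).
have U_int : G.-integrable setT (EFin \o (fun x => e * \1_U x)).
  apply: (@bounded_integrable _ _ (borel_cV R d) G _ e) => [|x].
    by apply: measurable_funM => //; exact: measurable_indic.
  rewrite indicE; case: (_ \in _); rewrite ?mulr1 ?mulr0 lexx ?andbT //=.
    exact: ltW.
  exact: ltW.
have -> : \int[shifted_measure]_x f x = \int[G]_x (f \o shift_on) x.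
  rewrite /Rintegral integral_distribution //.
  by apply/measurable_EFinP.
have GU_fin : (G U \is a fin_num) by exact: fin_num_measure.
apply: (@lt_le_trans _ _ (\int[G]_x (f x + e * \1_U x))).
  rewrite RintegralD // ltrDl RintegralZl //; last exact: integrable_indic.
  rewrite mulr_gt0 // /Rintegral integral_indic // setIT.
  by rewrite fine_gt0 // U_gt0 ltey_eq GU_fin.
apply: le_Rintegral => //.
  have -> : EFin \o (fun x => f x + e * \1_U x) =
      (EFin \o f) \+ (EFin \o (fun x => e * \1_U x)) by [].
  exact: integrableD.
move=> x _; rewrite indicE /= /shift_on.
case: ifPn => [/set_mem/f_incr|_]; first by rewrite mulr1.
by rewrite mulr0 addr0.
Qed.

End transport.

(** * Descent of the Mahalanobis distances off the manifold *)

(** By symmetry the two cross terms agree, and the form changes by exactly [e] times the quantity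
    assumed negative. *)
Lemma quad_form_descent (R : realType) (d : nat) (W : 'M[R]_d)
    (w v : 'cV[R]_d) (e : R) :
  W^T = W -> 0 < e ->
  e * (v^T *m W *m v) 0 0 + 2 * (v^T *m W *m w) 0 0 < 0 ->
  ((w + e *: v)^T *m W *m (w + e *: v)) 0 0 < (w^T *m W *m w) 0 0.
Proof.
move=> W_sym e_gt0 descent.
have wv : (w^T *m W *m v) 0 0 = (v^T *m W *m w) 0 0.
  have -> : w^T *m W *m v = (v^T *m W *m w)^T.
    by rewrite !trmx_mul trmxK W_sym mulmxA.
  by rewrite mxE.
suff -> : ((w + e *: v)^T *m W *m (w + e *: v)) 0 0 = (w^T *m W *m w) 0 0 +
    e * (e * (v^T *m W *m v) 0 0 + 2 * (v^T *m W *m w) 0 0).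
  by rewrite gtrDl pmulr_rlt0.
have -> : (w + e *: v)^T *m W *m (w + e *: v) = w^T *m W *m w +
    e *: (w^T *m W *m v) + (e *: (v^T *m W *m w) + e *: (e *: (v^T *m W *m v))).
  rewrite [(w + _)^T]linearD /= [(e *: v)^T]linearZ /= !mulmxDl !mulmxDr.
  by rewrite -!scalemxAl -!scalemxAr.
have mxD (A B : 'M[R]_1) : (A + B) 0 0 = A 0 0 + B 0 0 by rewrite mxE.
have mxZ a (A : 'M[R]_1) : (a *: A) 0 0 = a * A 0 0 by rewrite mxE.
by rewrite !mxD !mxZ wv; ring.
Qed.

Lemma common_ascent (R : realType) (n d : nat) (X : 'I_n -> 'cV[R]_d)
    (S : 'I_n -> 'M[R]_d) (x : 'cV[R]_d) :
  (0 < n)%N -> (forall i, posdefmx (S i)) -> ~ ridgeline_manifold X S x ->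
  exists v, forall i,
    gauss_density (S i) (X i - x) < gauss_density (S i) (X i - (x - v)).
Proof.
move=> n_gt0 S_pd x_off.
have [|v [c c_gt0 v_ge]] :=
    @gordan R n d (fun i => invmx (S i) *m (x - X i)) n_gt0.
  by move=> a a_simplex /(ridgelineP X x S_pd a_simplex) ax; apply: x_off; exists a.
have W_pd i := posdefmx_inv (S_pd i).
pose Q i := (v^T *m invmx (S i) *m v) 0 0.
have Q_ge0 i : 0 <= Q i.
  have [v0|v_neq0] := eqVneq v 0; first by rewrite /Q v0 mulmx0 mxE.
  by apply/ltW; have [_] := W_pd i; exact.
(* [C] bounds every [Q i], and the 1 keeps it positive even if [v] is zero. With step [c / C] the
   quadratic term is at most [c], while the linear term is at most [- 2 * c]. *)
pose C := 1 + \sum_i Q i.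
have C_gt0 : 0 < C by rewrite ltr_pwDl // sumr_ge0.
have Q_le i : Q i <= C.
  by rewrite /C (bigD1 i) //= addrCA lerDl addr_ge0 // sumr_ge0.
have e_gt0 : 0 < c / C by rewrite divr_gt0.
exists ((c / C) *: v) => i; apply: gauss_density_lt => //.
(* The displaced difference takes the form [w + e *: v] with [w = X i - x]. *)
rewrite opprB addrCA [X in X^T]addrC [X in _ *m X]addrC.
apply: quad_form_descent => //; first by case: (W_pd i).
have -> : (v^T *m invmx (S i) *m (X i - x)) 0 0 =
    - (v^T *m (invmx (S i) *m (x - X i))) 0 0.
  by rewrite -opprB mulmxN mxE mulmxA.
have eQ_le : c / C * Q i <= c.
  by rewrite mulrAC ler_pdivrMr // ler_pM2l.
have := v_ge i; rewrite -/(Q i); lra.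
Qed.

Theorem lemma3 (R : realType) (n d : nat) (n_ge1 : (1 <= n)%N) (d_ge1 : (1 <= d)%N)
    (X : 'I_n -> 'cV[R]_d) (Sigma : 'I_n -> 'M[R]_d)
    (Sigma_posdef : forall i, posdefmx (Sigma i)) :
  [/\ compact (ridgeline_manifold X Sigma),
      (forall G : probability (borel_cV R d) R,
        is_maximizer (log_likelihood X Sigma) G ->
        msupport G `<=` ridgeline_manifold X Sigma)
    & forall a : 'cV[R]_n, simplex R n a ->
        exists a' : 'cV[R]_n,
          [/\ simplex R n a',
              (#|[pred i | a' i 0%R != 0%R]| <= d.+1)%N
            & ridgeline X Sigma a = ridgeline X Sigma a']].
Proof.
split=> [|G G_max x x_supp|a a_simplex]; first exact: ridgeline_manifold_compact.
- apply: contrapT => x_off.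
  have [v v_ascent] := common_ascent n_ge1 Sigma_posdef x_off.
  pose f i (y : 'cV[R]_d) := gauss_density (Sigma i) (X i - y).
  have f_cont i : continuous (f i) by exact: gauss_density_continuous.
  have f_gt0 i y : 0 < f i y by exact: gauss_density_gt0.
  have f_bnd i y : 0 <= f i y <= gauss_density (Sigma i) 0.
    by rewrite ltW //= gauss_density_le0.
  pose gain i y := f i (y - v) - f i y.
  have gain_cont i y : {for y, continuous (gain i)}.
    rewrite /gain; apply: continuousB; last exact: f_cont.
    apply: (@continuous_comp _ _ _ (fun t : 'cV[R]_d => t - v) (f i)).
      by apply: continuousB; [exact: (fun _ => cvg_id)|exact: cst_continuous].
    exact: f_cont.
  have gain_gt0 i : 0 < gain i x by rewrite subr_gt0; exact: v_ascent.
  (* Asking for half of the gain at [x] leaves a uniform gain on [U], as [Rintegral_shifted_gt]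
     requires; [U] is open as a finite intersection of strict conditions on continuous functions. *)
  pose U := [set y | forall i, gain i x / 2 < gain i y].
  have U_open : open U.
    rewrite openE => y Uy; apply: (filter_forall (F := nbhs y)) => i.
    apply: (gain_cont i y [set z | gain i x / 2 < z]).
    apply: open_nbhs_nbhs; split; last exact: Uy.
    exact: open_gt.
  have U_gt0 : (0 < G U)%E.
    by apply: x_supp => // i; rewrite ltr_pdivrMr // mulr_natr mulr2n ltrDl.
  pose G' := shifted_measure G U_open v.
  have mix_lt i : gauss_mixture G (Sigma i) (X i) <
      gauss_mixture G' (Sigma i) (X i).
    apply: (Rintegral_shifted_gt (e := gain i x / 2) U_open
      (f_cont i) (f_bnd i) _ _ U_gt0); first by rewrite divr_gt0.
    by move=> y /(_ i)/ltW; rewrite lerBrDl.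
  (* Positivity places the mixtures where [ln] is strictly increasing. *)
  have mix_gt0 (H : probability (borel_cV R d) R) i :
      0 < gauss_mixture H (Sigma i) (X i).
    apply: (@Rintegral_gt0 _ _ (borel_cV R d) H (f i)); last exact: f_gt0.
    exact: bounded_integrable (continuous_borel (f_cont i)) (f_bnd i).
  have := G_max G'; rewrite leNgt => /negP; apply.
  rewrite /log_likelihood ltr_pM2l ?invr_gt0 ?ltr0n //.
  (* Strictness of the sum needs at least one index, which [n_ge1] provides. *)
  apply: ltr_sum => [|i _]; first by apply/hasP; exists (Ordinal n_ge1).
  by rewrite ltr_ln ?posrE.
(* The point stays fixed at [ridgeline X Sigma a]: the sparse weights inherit the vanishing
   combination, hence the same ridgeline point. *)
- pose u i := invmx (Sigma i) *m (ridgeline X Sigma a - X i).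
  have [a' [a'_simplex a'_card a'_sum]] := caratheodory u a_simplex.
  exists a'; split=> //; apply/esym/(ridgelineP X _ Sigma_posdef a'_simplex).
  by rewrite a'_sum; apply/(ridgelineP X _ Sigma_posdef a_simplex).
Qed.
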